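(* Let $f:\mathbb{R}^n\to\mathbb{R}$ be differentiable, $\mu$-strongly convex and $L$-smooth with minimizer $x^\star$, and let $(x_k,v_k)_{k\ge 0}$ be generated by the constant-stepsize fully implicit scheme described in the context, with stepsize $\alpha\ge 1$, fixed damping $\gamma>0$ and noise proxy $\sigma^2$. There exist constants $G>0$, $C>0$, depending on $\mu,L,\gamma$ but independent of $\alpha$, and a choice $\theta=\theta(\alpha)>0$ with $\theta=\Theta(1/\alpha)$ (i.e. $\theta_1/\alpha\le\theta\le\theta_2/\alpha$ for all $\alpha\ge1$ with constants $0<\theta_1\le\theta_2$ independent of $\alpha$), such that $$V_k:=\mathbb{E}\|x_k-x^\star\|^2+\theta\,\mathbb{E}\|x_{k-1}-x^\star\|^2$$ satisfies, for all $k\ge 1$, $$V_{k+1}\le \frac{G}{\alpha}V_k+\frac{C\sigma^2}{\alpha}.$$ Consequently, if $\alpha>G$ and $\rho:=G/\alpha\in(0,1)$, then for all $k\ge1$, $$V_k\le \rho^{k-1}V_1+\frac{C\sigma^2}{\alpha}\cdot\frac{1-\rho^{k-1}}{1-\rho},$$ and therefore $$\mathbb{E}\|x_k-x^\star\|^2\le V_k\le \rho^{k-1}V_1+\frac{C\sigma^2}{\alpha(1-G/\alpha)}.$$ In particular, if $\alpha\ge 2G$, then $$\limsup_{k\to\infty}\mathbb{E}\|x_k-x^\star\|^2\le\frac{2C}{\alpha}\sigma^2.$$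
   Context: Norms and inner products are Euclidean. Assumption on $f$: there are $0<\mu\le L<\infty$ such that for all $x,y\in\mathbb{R}^n$, $\frac{\mu}{2}\|x-y\|^2\le f(x)-f(y)-\langle\nabla f(y),x-y\rangle\le\frac{L}{2}\|x-y\|^2$; $x^\star=\arg\min f$. For $\lambda>0$, $\mathrm{prox}_{\lambda f}(z)=\arg\min_x\{\lambda f(x)+\frac12\|x-z\|^2\}$, i.e. $\mathrm{prox}_{\lambda f}=(\mathrm{Id}+\lambda\nabla f)^{-1}$. Scheme (constant stepsize $\alpha\ge1$, frozen damping $\gamma>0$; $\mu$ is the strong convexity constant): set $$\tau=\frac1\alpha+\frac{\mu}{\gamma},\qquad \lambda=\frac{\alpha}{\gamma(1+\tau)}.$$ Given $x_0,v_0\in\mathbb{R}^n$, for $k\ge0$: $$c_k=\frac{v_k+\tau x_k}{1+\tau},\qquad \xi_k=\frac{\sqrt{\alpha}}{1+\tau}\Sigma^{1/2}\eta_k,\qquad x_{k+1}=\mathrm{prox}_{\lambda f}(c_k+\xi_k),\qquad v_{k+1}=x_{k+1}+\frac{x_{k+1}-x_k}{\alpha}.$$ Noise: $\eta_k\sim\mathcal N(0,I_n)$ are independent (normalized Brownian increments), $\Sigma\succeq0$ is a fixed covariance matrix, and $\sigma^2=\mathrm{tr}(\Sigma)$ (or any upper bound on $\mathbb{E}\|\Sigma^{1/2}\eta_k\|^2$). *)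

(* Defs.v *)
From HB Require Import structures.
From mathcomp Require Import all_boot all_order all_algebra.
From mathcomp Require Import all_classical all_reals all_analysis.
Set Implicit Arguments.
Unset Strict Implicit.
Unset Printing Implicit Defensive.
Import Order.TTheory GRing.Theory Num.Theory.
Import numFieldNormedType.Exports.
Local Open Scope classical_set_scope.
Local Open Scope ring_scope.

(* The library norm on matrices is the sup norm, which induces the same
   topology (hence the same differentiability) as the Euclidean norm. *)
Definition dotp (R : realType) (n : nat) (u v : 'cV[R]_n) : R :=
  \sum_(i < n) u i 0 * v i 0.

Definition enorm (R : realType) (n : nat) (u : 'cV[R]_n) : R :=
  Num.sqrt (dotp u u).

Definition grad (R : realType) (n : nat) (f : 'cV[R]_n -> R) (x : 'cV[R]_n) :
  'cV[R]_n := \col_(i < n) 'D_(delta_mx i 0) f x.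

Definition strongly_convex_smooth (R : realType) (n : nat) (mu L : R)
    (f : 'cV[R]_n -> R) : Prop :=
  (forall x, differentiable f x) /\
  (forall x y, mu / 2 * enorm (x - y) ^+ 2
                 <= f x - f y - dotp (grad f y) (x - y)
                 <= L / 2 * enorm (x - y) ^+ 2).

Definition is_argmin (R : realType) (T : Type) (F : T -> R) (x : T) : Prop :=
  forall y, F x <= F y.

Definition is_prox (R : realType) (n : nat) (lambda : R) (f : 'cV[R]_n -> R)
    (z p : 'cV[R]_n) : Prop :=
  is_argmin (fun x => lambda * f x + enorm (x - z) ^+ 2 / 2) p.

Definition psdmx (R : realType) (n : nat) (A : 'M[R]_n) : Prop :=
  A^T = A /\ forall u, 0 <= dotp u (A *m u).

(* S is the (unique) positive semidefinite square root of A. *)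
Definition is_sqrtmx (R : realType) (n : nat) (A S : 'M[R]_n) : Prop :=
  psdmx S /\ S *m S = A.

Definition borel_cV (R : realType) (n : nat) : set (set 'cV[R]_n) :=
  <<s [set U : set 'cV[R]_n | open U] >>.

Definition random_vector (R : realType) (n : nat) (d : measure_display)
    (T : measurableType d) (X : T -> 'cV[R]_n) : Prop :=
  forall B, borel_cV B -> measurable (X @^-1` B).

(* N(0, I_n): the law of X is the product of n standard normal laws. *)
Definition std_gaussian (R : realType) (n : nat) (d : measure_display)
    (T : measurableType d) (P : probability T R) (X : T -> 'cV[R]_n) : Prop :=
  random_vector X /\
  forall A : 'I_n -> set R, (forall i, measurable (A i)) ->
    P [set w | forall i, A i (X w i 0)] =
    (\prod_(i < n) normal_prob (0 : R) 1 (A i))%E.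

Definition mutually_independent (R : realType) (n : nat) (d : measure_display)
    (T : measurableType d) (P : probability T R) (X : nat -> T -> 'cV[R]_n) :
    Prop :=
  forall (s : seq nat) (B : nat -> set 'cV[R]_n), uniq s ->
    (forall k, borel_cV (B k)) ->
    P [set w | forall k, k \in s -> B k (X k w)] =
    (\prod_(k <- s) P (X k @^-1` B k))%E.

Definition tau (R : realType) (mu alpha gamma : R) : R :=
  alpha^-1 + mu / gamma.

Definition lambda (R : realType) (mu alpha gamma : R) : R :=
  alpha / (gamma * (1 + tau mu alpha gamma)).

(* S stands for the square root of the covariance matrix of the noise. *)
Definition implicit_scheme (R : realType) (n : nat) (T : Type)
    (f : 'cV[R]_n -> R) (mu alpha gamma : R) (S : 'M[R]_n)
    (eta : nat -> T -> 'cV[R]_n) (x0 v0 : 'cV[R]_n)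
    (x v : nat -> T -> 'cV[R]_n) : Prop :=
  let t := tau mu alpha gamma in
  forall w : T,
    [/\ x 0%N w = x0, v 0%N w = v0 &
      forall k : nat,
        let c := (1 + t)^-1 *: (v k w + t *: x k w) in
        let xi := (Num.sqrt alpha / (1 + t)) *: (S *m eta k w) in
        is_prox (lambda mu alpha gamma) f (c + xi) (x k.+1 w) /\
        v k.+1 w = x k.+1 w + alpha^-1 *: (x k.+1 w - x k w)].

Definition noise_proxy (R : realType) (n : nat) (d : measure_display)
    (T : measurableType d) (P : probability T R) (Sigma S : 'M[R]_n)
    (eta : nat -> T -> 'cV[R]_n) (sigma2 : R) : Prop :=
  sigma2 = \tr Sigma \/
  forall k, ('E_P[fun w => (enorm (S *m eta k w) ^+ 2)%R] <= sigma2%:E)%E.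

Definition mean_sq_error (R : realType) (n : nat) (d : measure_display)
    (T : measurableType d) (P : probability T R) (x : nat -> T -> 'cV[R]_n)
    (xstar : 'cV[R]_n) (k : nat) : \bar R :=
  ('E_P[fun w => (enorm (x k w - xstar) ^+ 2)%R])%E.

(* Only meaningful for 1 <= k, because of the truncated predecessor. *)
Definition lyapunov (R : realType) (n : nat) (d : measure_display)
    (T : measurableType d) (P : probability T R) (x : nat -> T -> 'cV[R]_n)
    (xstar : 'cV[R]_n) (theta : R) (k : nat) : \bar R :=
  (mean_sq_error P x xstar k + theta%:E * mean_sq_error P x xstar k.-1)%E.

(* Main.v *)
Require Import Defs.
From HB Require Import structures.
From mathcomp Require Import all_boot all_order all_algebra.
From mathcomp Require Import all_classical all_reals all_analysis.
From mathcomp Require Import measurable_realfun ring lra.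
Set Implicit Arguments.
Unset Strict Implicit.
Unset Printing Implicit Defensive.
Import Order.TTheory GRing.Theory Num.Theory.
Import numFieldNormedType.Exports.
Local Open Scope classical_set_scope.
Local Open Scope ring_scope.

(** One step of the scheme is a proximal step, and the proximal map of a
    mu-strongly convex function contracts distances to the minimizer by
    1 / (1 + lambda mu) ([prox_contraction]).  Here
    (1 + tau) (1 + lambda mu) = 1 + tau + alpha mu / gamma, so for a large
    stepsize the contraction factor times 1 / (1 + tau) is of order 1 / alpha:
    implicitness lets the contraction improve with the stepsize.

    The argument of the proximal map, relative to the minimizer and multiplied
    by 1 + tau, is (v_k - xstar) + tau (x_k - xstar) + sqrt(alpha) S eta_k, with
    S the square root of the covariance matrix.  Bounding the square of this sum
    of three terms by three times the sum of the squares gives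
    [implicit_step_bound], in which the state terms carry a factor 1 / alpha^2
    and the noise term a factor 1 / alpha.  Replacing v_k by its definition in
    terms of x_k and x_{k-1} ([velocity_bound]) and taking expectations
    ([mse_recursion]) yields a two-step recursion

      m_{k+2} <= A / alpha^2 m_{k+1} + B / alpha^4 m_k + C sigma^2 / alpha

    for the mean square errors.  With theta = 1 / alpha the Lyapunov function
    absorbs the delayed term: theta m_{k+1} costs m_{k+1} / alpha, and
    B / alpha^4 m_k is at most B / alpha times theta m_k, so G = A + B + 1
    suffices ([lyapunov_contraction]).  The remaining conclusions unroll this
    affine recursion ([affine_recursion_le], [limn_esup_geometric_le]).  Since
    the constants are free, the crude bound on the square of a sum replaces the
    cancellation of the cross term between state and noise.

    Two facts of measure theory are needed.  The second moment of the noise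
    must be controlled by the trace of the covariance matrix with a constant
    independent of the dimension ([gaussian_noise_second_moment]); this uses
    that distinct coordinates of a standard Gaussian vector are uncorrelated.
    And the iterates must be measurable for expectations to be additive: they
    are, because the proximal map is 1-Lipschitz ([lipschitz_measurable]). *)

(** * Euclidean geometry *)

Section Euclidean.
Context {R : realType} {n : nat}.
Implicit Types (u v w : 'cV[R]_n) (a : R).

Lemma dotpC u v : dotp u v = dotp v u.
Proof. by apply: eq_bigr => i _; rewrite mulrC. Qed.

Lemma dotpDl u v w : dotp (u + v) w = dotp u w + dotp v w.
Proof. by rewrite -big_split; apply: eq_bigr => i _; rewrite !mxE mulrDl. Qed.

Lemma dotpZl a u v : dotp (a *: u) v = a * dotp u v.
Proof. by rewrite mulr_sumr; apply: eq_bigr => i _; rewrite !mxE mulrA. Qed.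

Lemma dotpNl u v : dotp (- u) v = - dotp u v.
Proof. by rewrite -scaleN1r dotpZl mulN1r. Qed.

Lemma dotpDr u v w : dotp w (u + v) = dotp w u + dotp w v.
Proof. by rewrite !(dotpC w) dotpDl. Qed.

Lemma dotpZr a u v : dotp u (a *: v) = a * dotp u v.
Proof. by rewrite !(dotpC u) dotpZl. Qed.

Lemma dotpNr u v : dotp u (- v) = - dotp u v.
Proof. by rewrite !(dotpC u) dotpNl. Qed.

Definition dotpE := (dotpDl, dotpDr, dotpNl, dotpNr, dotpZl, dotpZr).

Lemma dotp_ge0 u : 0 <= dotp u u.
Proof. by apply: sumr_ge0 => i _; rewrite -expr2 sqr_ge0. Qed.

Lemma enorm2E u : enorm u ^+ 2 = dotp u u.
Proof. by rewrite /enorm sqr_sqrtr // dotp_ge0. Qed.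

Lemma dotp_eq0 u : dotp u u <= 0 -> u = 0.
Proof.
move=> u0; have /eqP : dotp u u = 0 by apply/eqP; rewrite eq_le u0 dotp_ge0.
rewrite psumr_eq0 => [|i _]; last by rewrite -expr2 sqr_ge0.
move=> /allP ui0; apply/colP => i; rewrite mxE.
by have /eqP := ui0 i (mem_index_enum _); move/eqP; rewrite /= mulf_eq0 orbb => /eqP.
Qed.

Lemma dotpDD_le u v : dotp (u + v) (u + v) <= 2 * (dotp u u + dotp v v).
Proof.
have := dotp_ge0 (u - v); rewrite !dotpE (dotpC v u); lra.
Qed.

Lemma dotpDDD_le u v w :
  dotp (u + v + w) (u + v + w) <= 3 * (dotp u u + dotp v v + dotp w w).
Proof.
have := dotp_ge0 (u - v); have := dotp_ge0 (u - w).
have := dotp_ge0 (v - w).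
rewrite !dotpE (dotpC v u) (dotpC w u) (dotpC w v); lra.
Qed.

Lemma entry_le_enorm u i : `|u i 0| <= enorm u.
Proof.
rewrite -sqrtr_sqr ler_wsqrtr // /dotp (bigD1 i) //= -expr2 lerDl.
by apply: sumr_ge0 => j _; rewrite -expr2 sqr_ge0.
Qed.

Lemma enorm_le_sum u : enorm u <= \sum_i `|u i 0|.
Proof.
have s0 : 0 <= \sum_i `|u i 0| by apply: sumr_ge0.
rewrite -[leRHS]ger0_norm // -sqrtr_sqr ler_wsqrtr // expr2 mulr_suml.
apply: ler_sum => i _; apply: le_trans (ler_norm _) _; rewrite normrM ler_wpM2l //.
by rewrite (bigD1 i) //= lerDl sumr_ge0.
Qed.

End Euclidean.

(** * Proximal steps of strongly convex smooth functions *)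

Section Prox.
Context {R : realType} {n : nat} {mu L : R} {f : 'cV[R]_n -> R}.
Hypothesis mu_gt0 : 0 < mu.
Hypothesis mu_le_L : mu <= L.
Hypothesis fP : strongly_convex_smooth mu L f.
Implicit Types (x y z p : 'cV[R]_n) (l : R).

Lemma grad_strongly_monotone x y :
  mu * dotp (x - y) (x - y) <= dotp (grad f x - grad f y) (x - y).
Proof.
have [_ q] := fP.
have /andP[h1 _] := q x y; have /andP[h2 _] := q y x.
move: h1 h2; rewrite !enorm2E !dotpE !(dotpC y x); lra.
Qed.

(** At a minimizer the upper quadratic bound leaves no room for decrease along
    the gradient step of length 1 / L, which would gain |grad f x|^2 / (2 L). *)
Lemma argmin_grad_eq0 x : is_argmin f x -> grad f x = 0.
Proof.
move=> minx; apply: dotp_eq0.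
have L_gt0 : 0 < L by exact: lt_le_trans mu_le_L.
have [_ /(_ (x - L^-1 *: grad f x) x)] := fP.
move=> /andP[_]; have := minx (x - L^-1 *: grad f x).
rewrite (addrC x) addrK enorm2E !dotpE.
set s := dotp _ _.
have -> : L / 2 * - - (L^-1 * (L^-1 * s)) = L^-1 * s / 2.
  by field; rewrite gt_eqF.
have : 0 <= L^-1 * s by rewrite mulr_ge0 ?invr_ge0 ?dotp_ge0 // ltW.
move=> h1 h2 h3; have : L^-1 * s <= 0 by lra.
by rewrite pmulr_rle0 // invr_gt0.
Qed.

(** The proximal objective has the gradient [g] below at [p] and is
    (l L + 1)-smooth, so the descent step that kills the gradient of a smooth
    function at its minimizer applies to it; no derivative of the objective is
    taken. *)
Lemma prox_stationary l z p : 0 <= l -> is_prox l f z p ->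
  z = p + l *: grad f p.
Proof.
move=> l_ge0 prox_p; pose g := p - z + l *: grad f p; pose M := l * L + 1.
have L_ge0 : 0 <= L by apply/ltW; exact: lt_le_trans mu_le_L.
have M_gt0 : 0 < M by rewrite /M ltr_wpDl // mulr_ge0.
suff : g = 0 by move=> /eqP; rewrite /g addrAC subr_eq0 => /eqP.
apply: dotp_eq0.
have [_ /(_ (p - M^-1 *: g) p) /andP[_ up]] := fP.
have := prox_p (p - M^-1 *: g); rewrite /=.
have {}up := ler_wpM2l l_ge0 up.
have -> : p - M^-1 *: g - z = (p - z) - M^-1 *: g by rewrite addrAC.
move: up; rewrite (addrC p) addrK !enorm2E.
have gg : dotp g g = dotp (p - z) g + l * dotp (grad f p) g.
  by rewrite {1}/g dotpDl dotpZl.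
move: gg; rewrite !(dotpNl (M^-1 *: g), dotpNr, dotpZl, dotpZr).
rewrite [dotp (p - z - _) _]dotpDl ![dotp _ (p - z - _)]dotpDr.
rewrite !(dotpNl (M^-1 *: g), dotpNr, dotpZl, dotpZr) (dotpC g (p - z)).
set s := dotp g g; set a := dotp (p - z) g; set b := dotp (grad f p) g.
set k := M^-1 => gg up opt.
have kM : k * M = 1 by rewrite mulVf // gt_eqF.
have k_gt0 : 0 < k by rewrite invr_gt0.
have ks : l * (L / 2 * - - (k * (k * s))) + k * (k * s) / 2 = k * s / 2.
  have := congr1 (fun r : R => r * (k * s)) kM; rewrite /M /=; lra.
have : k * s / 2 <= 0.
  move: up opt ks.
  have : k * s = k * a + l * (k * b) by rewrite gg; ring.
  lra.
by rewrite -mulrA pmulr_rle0 // => h; lra.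
Qed.

(** The map p |-> p + l grad f p, inverse to the proximal map, is strongly
    monotone with constant 1 + l mu, hence expands distances by that factor:
    expand |e' - (1 + l mu) d|^2 >= 0 with d the difference of the points and
    e' that of their images. *)
Lemma stationary_contraction l p q : 0 <= l ->
  (1 + l * mu) ^+ 2 * dotp (p - q) (p - q) <=
  dotp (p + l *: grad f p - (q + l *: grad f q))
       (p + l *: grad f p - (q + l *: grad f q)).
Proof.
move=> l_ge0.
have := ler_wpM2l l_ge0 (grad_strongly_monotone p q).
set d := p - q; set e := grad f p - grad f q => de.
have -> : p + l *: grad f p - (q + l *: grad f q) = d + l *: e.
  by rewrite /d /e scalerBr opprD addrACA.
clearbody d e; have := dotp_ge0 (d + l *: e - (1 + l * mu) *: d).
rewrite !dotpE (dotpC d e).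
move: de; set a := dotp d d; set b := dotp e d; set c := dotp e e.
move=> h1 h2.
have h3 : 0 <= (1 + l * mu) * (l * b - l * (mu * a)).
  by rewrite mulr_ge0 ?subr_ge0 // addr_ge0 // mulr_ge0 // ltW.
nra.
Qed.

(** A minimizer is a fixed point of the proximal map because its gradient
    vanishes. *)
Lemma prox_contraction l xstar z p : 0 <= l -> is_argmin f xstar ->
  is_prox l f z p ->
  (1 + l * mu) ^+ 2 * dotp (p - xstar) (p - xstar) <=
  dotp (z - xstar) (z - xstar).
Proof.
move=> l_ge0 /argmin_grad_eq0 gx /(prox_stationary l_ge0) ->.
by have := stationary_contraction p xstar l_ge0; rewrite gx scaler0 addr0.
Qed.

Lemma prox_nonexpansive l z z' p p' : 0 <= l ->
  is_prox l f z p -> is_prox l f z' p' -> enorm (p - p') <= enorm (z - z').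
Proof.
move=> l_ge0 /(prox_stationary l_ge0) -> /(prox_stationary l_ge0) ->.
rewrite ler_wsqrtr //; apply: le_trans (stationary_contraction p p' l_ge0).
rewrite ler_peMl ?dotp_ge0 // expr_ge1 // ?lerDl ?addr_ge0 ?mulr_ge0 //; exact: ltW.
Qed.

End Prox.

(** * Measurability of Lipschitz images of random vectors *)

Section Measurability.
Context {R : realType} {n : nat} {d : measure_display} {T : measurableType d}.

Definition measurable_entries (X : T -> 'cV[R]_n) : Prop :=
  forall i, measurable_fun setT (fun w => X w i 0).

Lemma random_vector_entries (X : T -> 'cV[R]_n) :
  random_vector X -> measurable_entries X.
Proof.
move=> mX i; apply: (measurability _ (RGenOInfty.measurableE R)) => //.
move=> _ [_ [a ->] <-]; rewrite setTI.
apply: (mX [set u : 'cV[R]_n | `]a, +oo[%classic (u i 0)]).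
apply: sub_sigma_algebra.
by apply: (@open_comp _ _ (fun u : 'cV[R]_n => u i 0));
   [move=> u _; exact: coord_continuous|exact: interval_open].
Qed.

(** [Y] is a 1-Lipschitz function of [X] for the l1 distance, but only on the
    range of [X]: stating this as a condition on pairs of outcomes avoids
    extending the function (here, the proximal map, known only where a
    proximal point is given) to the whole space.  The set where [Y > r] is a
    union of preimages under [X] of l1-balls with rational centres. *)
Lemma lipschitz_measurable (X : T -> 'cV[R]_n) (Y : T -> R) :
    measurable_entries X ->
    (forall w w', `|Y w - Y w'| <= \sum_i `|X w i 0 - X w' i 0|) ->
  measurable_fun setT Y.
Proof.
move=> mX lipY; apply: (measurability _ (RGenOInfty.measurableE R)) => //.
move=> _ [_ [r ->] <-]; rewrite setTI.
(* Preimages of the l1-balls with centre q.1 and radius 1 / (q.2 + 1). *)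
pose D (q : {ffun 'I_n -> rat} * nat) : set T :=
  [set w | \sum_i `|X w i 0 - ratr (q.1 i)| < q.2.+1%:R^-1].
have mD q : measurable (D q).
  rewrite -[D q]setTI.
  have mS : measurable_fun setT (fun w => \sum_i `|X w i 0 - ratr (q.1 i)|).
    apply: measurable_sum => i; apply: measurableT_comp => //.
    exact: measurable_funB.
  have := mS measurableT `]-oo, q.2.+1%:R^-1[%classic (measurable_itv _).
  by congr (measurable (_ `&` _)); apply/seteqP; split => w /=; rewrite in_itv.
pose I := [set q | D q `<=` Y @^-1` `]r, +oo[%classic].
suff -> : Y @^-1` `]r, +oo[%classic = \bigcup_(q in I) D q.
  rewrite bigcup_mkcond; apply: countable_bigcupT_measurable => [|q].
    exact: countableP.
  by case: ifP.
apply/seteqP; split => w /=; last by move=> [q Iq /Iq].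
rewrite in_itv /= andbT => rY.
have Yr : 0 < Y w - r by rewrite subr_gt0.
(* Two outcomes in the same ball differ by less than twice its radius under Y,
   so a radius below half the margin Y w - r keeps the ball above r. *)
have [m Hm] : exists m, (m.+1%:R^-1 : R) < (Y w - r) / 2.
  exists (Num.truncn ((Y w - r) / 2)^-1).
  rewrite invf_plt ?posrE ?divr_gt0 //.
  exact: truncnS_gt.
pose e : R := m.+1%:R^-1.
have e_gt0 : 0 < e by rewrite invr_gt0 ltr0n.
have [q Hq] : exists q : {ffun 'I_n -> rat},
    \sum_i `|X w i 0 - ratr (q i)| < e.
  have Hi (i : 'I_n) : {q : rat | `|X w i 0 - ratr q| < e / n.+1%:R}.
    apply: cid; have : X w i 0 - e / n.+1%:R < X w i 0 + e / n.+1%:R.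
      by rewrite ltrD2l gtrN // divr_gt0.
    move=> /rat_in_itvoo[q]; rewrite in_itv /= => /andP[q1 q2].
    by exists q; rewrite distrC ltr_distl q1.
  exists [ffun i => sval (Hi i)].
  apply: (@le_lt_trans _ _ (\sum_(i < n) e / n.+1%:R)).
    by apply: ler_sum => i _; rewrite ffunE ltW //; exact: (svalP (Hi i)).
  rewrite sumr_const card_ord -(mulr_natr (e / _)) mulrAC ltr_pdivrMr //.
  by rewrite ltr_pM2l // ltr_nat.
exists (q, m) => // w' /= Dw'; rewrite in_itv /= andbT.
have : `|Y w - Y w'| < e + e.
  apply: le_lt_trans (lipY w w') _; apply: le_lt_trans (ltrD Hq Dw').
  rewrite -big_split; apply: ler_sum => i _ /=.
  by rewrite (distrC (X w' i 0)) ler_distD.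
rewrite ltr_norml => /andP[_]; move: Hm; rewrite -/e; lra.
Qed.

End Measurability.

(** * Moments of the standard normal law *)

Section StandardNormal.
Context {R : realType}.
Local Notation leb := (@lebesgue_measure R).
Local Notation N01 := (@normal_prob R 0 1).

(** The density of the normal law agrees almost everywhere with its
    Radon-Nikodym derivative, for which the change of variables is known. *)
Lemma ge0_integral_normal_prob (m s : R) (h : R -> \bar R) :
    measurable_fun setT h -> (forall x, 0 <= h x)%E ->
  (\int[normal_prob m s]_x h x =
   \int[leb]_x (h x * (normal_pdf m s x)%:E))%E.
Proof.
move=> mh h0; have dom := normal_prob_dominates m s.
rewrite -(Radon_Nikodym_SigmaFinite.change_of_variables dom) //.
have mpdf := measurable_normal_pdf m s.
apply: ae_eq_integral => //.
- apply: emeasurable_funM => //; apply: measurable_int.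
  exact: (Radon_Nikodym_SigmaFinite.f_integrable dom).
- by apply: emeasurable_funM => //; exact/measurable_EFinP.
- apply: ae_eqe_mul2l; apply: integral_ae_eq => //.
  + exact: Radon_Nikodym_SigmaFinite.f_integrable.
  + exact/measurable_EFinP.
  + by move=> A _ mA; rewrite -Radon_Nikodym_SigmaFinite.f_integral.
Qed.

(** Trading half of the Gaussian exponent for the square, through
    x^2 / 4 <= exp (x^2 / 4), bounds x^2 times the standard density by a
    multiple of the density of variance 2.  Any finite bound on the second
    moment is enough, as it only enters a constant. *)
Lemma sqr_normal_pdf_le (x : R) :
  x ^+ 2 * normal_pdf 0 1 x <=
  4 * (normal_peak 1 / normal_peak (Num.sqrt 2)) *
    normal_pdf 0 (Num.sqrt 2) x.
Proof.
have s2 : Num.sqrt 2 != 0 :> R by rewrite gt_eqF // sqrtr_gt0.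
have p2 := normal_peak_gt0 s2; have p1 := normal_peak_ge0 (1 : R).
have e1 : normal_fun 0 1 x = expR (- (x ^+ 2 / 4)) * expR (- (x ^+ 2 / 4)).
  by rewrite -expRD /normal_fun subr0; congr expR; field.
have e2 : normal_fun 0 (Num.sqrt 2) x = expR (- (x ^+ 2 / 4)).
  by rewrite /normal_fun subr0 sqr_sqrtr //; congr expR; field.
rewrite (normal_pdfE _ (oner_neq0 _)) (normal_pdfE _ s2) e1 e2.
set e := expR _.
have -> : 4 * (normal_peak 1 / normal_peak (Num.sqrt 2)) *
    (normal_peak (Num.sqrt 2) * e) = normal_peak 1 * e * 4 :> R.
  by field; rewrite gt_eqF.
have -> : x ^+ 2 * (normal_peak 1 * (e * e)) =
    normal_peak 1 * e * (x ^+ 2 * e) by ring.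
rewrite ler_wpM2l ?mulr_ge0 ?expR_ge0 // /e expRN ler_pdivrMr ?expR_gt0 //.
have := expR_ge1Dx (x ^+ 2 / 4); lra.
Qed.

Lemma normal_second_moment_bounded :
  exists2 M : R, 1 <= M & (\int[N01]_x (x ^+ 2)%:E <= M%:E)%E.
Proof.
set c : R := 4 * (normal_peak 1 / normal_peak (Num.sqrt 2)).
have c_ge0 : 0 <= c by rewrite mulr_ge0 // divr_ge0 // normal_peak_ge0.
exists (1 + c); first by rewrite lerDl.
rewrite ge0_integral_normal_prob; last 2 first.
- by apply/measurable_EFinP; exact: measurable_funX.
- by move=> x; rewrite lee_fin sqr_ge0.
apply: (@le_trans _ _ (\int[leb]_x (c%:E * (normal_pdf 0 (Num.sqrt 2) x)%:E))%E).
  apply: ge0_le_integral => //.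
  - by move=> x _; rewrite mule_ge0 // lee_fin ?sqr_ge0 ?normal_pdf_ge0.
  - apply: emeasurable_funM; apply/measurable_EFinP => //.
    exact: measurable_normal_pdf.
  - apply: emeasurable_funM; apply/measurable_EFinP => //.
    exact: measurable_normal_pdf.
  - by move=> x _; rewrite -!EFinM lee_fin; exact: sqr_normal_pdf_le.
rewrite ge0_integralZl //.
- by rewrite integral_normal_pdf mule1 lee_fin lerDr.
- by apply/measurable_EFinP; exact: measurable_normal_pdf.
- by move=> x _; rewrite lee_fin normal_pdf_ge0.
Qed.

Lemma ge0_integralT_opp (g : R -> \bar R) :
    measurable_fun setT g -> (forall x, 0 <= g x)%E ->
  (\int[leb]_x g (- x)%R = \int[leb]_x g x)%E.
Proof.
move=> mg g0; pose opp : measurableTypeR R -> measurableTypeR R := -%R.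
have mopp : measurable_fun setT opp by exact: oppr_measurable.
rewrite -[LHS](@ge0_integral_pushforward _ _ _ _ _ _ mopp leb setT g) //.
by apply: eq_measure_integral => A mA _; exact: lebesgue_measureN.
Qed.

Lemma normal_abs_moment_fin : (\int[N01]_x `|x|%:E < +oo)%E.
Proof.
have [M _ le_M] := normal_second_moment_bounded.
have mx2 : measurable_fun setT (fun x : R => (x ^+ 2)%:E).
  by apply/measurable_EFinP; exact: measurable_funX.
apply: (@le_lt_trans _ _ (\int[N01]_x (1%:E + (x ^+ 2)%:E))%E).
  apply: ge0_le_integral => //.
  - by apply/measurable_EFinP; exact: normr_measurable.
  - exact: emeasurable_funD.
  - move=> x _; rewrite -EFinD lee_fin.
    have := sqr_ge0 (`|x| - 1); rewrite sqrrB1 real_normK ?num_real //.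
    have := normr_ge0 x; rewrite mulr2n; lra.
rewrite ge0_integralD //; last by move=> x _; rewrite lee_fin sqr_ge0.
rewrite integral_cst // [X in (_ * X)%E](@probability_setT _ _ _ N01) mule1.
by rewrite lte_add_pinfty ?ltry // (le_lt_trans le_M) // ltry.
Qed.

(** The positive and negative parts of x have the same integral since the
    density is even; finiteness of the first absolute moment is needed for
    their difference to vanish. *)
Lemma normal_mean0 : (\int[N01]_x x%:E = 0)%E.
Proof.
pose p (x : R) := Num.max x 0.
have p0 x : 0 <= p x by rewrite le_max lexx orbT.
have mp : measurable_fun setT p by exact: measurable_maxr.
have pdfN (x : R) : normal_pdf 0 1 (- x) = normal_pdf 0 1 x.
  by rewrite !(normal_pdfE _ (oner_neq0 _)) /normal_fun !subr0 sqrrN.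
rewrite integralE.
have -> : (\int[N01]_x (fun x : R => x%:E)^\+%E x = \int[N01]_x (p x)%:E)%E.
  by apply: eq_integral => x _; rewrite funeposE /p EFin_max.
have -> : (\int[N01]_x (fun x : R => x%:E)^\-%E x = \int[N01]_x (p (- x))%:E)%E.
  by apply: eq_integral => x _; rewrite funenegE /p EFin_max EFinN.
have fin : (\int[N01]_x (p x)%:E \is a fin_num)%E.
  rewrite ge0_fin_numE; last by apply: integral_ge0 => x _; rewrite lee_fin.
  apply: le_lt_trans normal_abs_moment_fin; apply: ge0_le_integral => //.
  - by move=> x _; rewrite lee_fin.
  - exact/measurable_EFinP.
  - by apply/measurable_EFinP; exact: normr_measurable.
  - by move=> x _; rewrite lee_fin ge_max ler_norm normr_ge0.
move: fin; rewrite !ge0_integral_normal_prob //; last 3 first.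
- by apply/measurable_EFinP; apply: measurableT_comp.
- by move=> x; rewrite lee_fin.
- exact/measurable_EFinP.
have -> : (\int[leb]_x ((p (- x))%:E * (normal_pdf 0 1 x)%:E) =
    \int[leb]_x ((p x)%:E * (normal_pdf 0 1 x)%:E))%E.
  rewrite -[RHS]ge0_integralT_opp.
  - by apply: eq_integral => x _; rewrite pdfN.
  - apply: emeasurable_funM; apply/measurable_EFinP => //.
    exact: measurable_normal_pdf.
  - by move=> x; rewrite mule_ge0 // lee_fin ?normal_pdf_ge0.
exact: subee.
Qed.

End StandardNormal.

(** * Second moments of Gaussian noise *)

Section GaussianVector.
Context {R : realType} {d : measure_display} {T : measurableType d}.
Variable P : probability T R.
Local Notation N01 := (@normal_prob R 0 1).
Local Open Scope ereal_scope.

Lemma normal_ge0_transfer (X : T -> R) (h : R -> \bar R) :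
    measurable_fun setT X ->
    (forall A, measurable A -> P (X @^-1` A) = N01 A) ->
    measurable_fun setT h -> (forall x, 0 <= h x) ->
  \int[P]_w h (X w) = \int[N01]_x h x.
Proof.
move=> mX PX mh h0.
(* The target carries the sigma-algebra on which the normal law is defined. *)
pose X' : {mfun T >-> measurableTypeR R} :=
  HB.pack X (isMeasurableFun.Build _ _ T (measurableTypeR R) X mX).
rewrite -[LHS](ge0_integral_distribution X') //.
by apply: eq_measure_integral => A mA _; exact: PX.
Qed.

(** The joint law agrees with a product of normal laws on rectangles, hence
    everywhere, and Fubini reduces the expectation of the product to the
    vanishing mean. *)
Lemma normal_pair_uncorrelated (X Y : T -> R) :
    measurable_fun setT X -> measurable_fun setT Y ->
    (forall A B, measurable A -> measurable B ->
      P (X @^-1` A `&` Y @^-1` B) = N01 A * N01 B) ->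
    P.-integrable setT (fun w => (X w * Y w)%:E) ->
  \int[P]_w (X w * Y w)%:E = 0.
Proof.
move=> mX mY PXY iXY.
have mXY : measurable_fun setT (fun w => (X w, Y w)).
  exact: measurable_fun_pair.
pose h (z : R * R) : \bar R := (z.1 * z.2)%:E.
have mh : measurable_fun setT h.
  by apply/measurable_EFinP; apply: measurable_funM.
pose XY : {mfun T >-> (measurableTypeR R * measurableTypeR R)%type} :=
  HB.pack (fun w => (X w, Y w)) (isMeasurableFun.Build _ _ T
    (measurableTypeR R * measurableTypeR R)%type _ mXY).
have law A : measurable A -> (N01 \x N01) A = distribution P XY A.
  by apply: product_measure_unique => B C mB mC; exact: PXY.
have -> : \int[P]_w (X w * Y w)%:E = \int[N01 \x N01]_z h z.
  rewrite -[LHS](@integral_distribution _ _ _ _ _ P XY h) //.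
  by apply: eq_measure_integral => A mA _; exact/esym/law.
have ih : (N01 \x N01).-integrable setT h.
  apply/integrable12ltyP => //.
  have mabs : measurable_fun setT (fun x : R => `|x|%:E).
    by apply/measurable_EFinP; exact: normr_measurable.
  have fin : \int[N01]_x `|x|%:E \is a fin_num.
    by rewrite ge0_fin_numE ?integral_ge0 // normal_abs_moment_fin.
  under eq_integral => x _.
    under eq_integral do rewrite /h /= normrM EFinM.
    rewrite ge0_integralZl //; over.
  rewrite ge0_integralZr //; last exact: integral_ge0.
  by rewrite -(fineK fin) -EFinM ltry.
rewrite -integral12_prod_meas1 //.
rewrite integral0_eq // => x _; rewrite /fubini_F /h /=.
under eq_integral do rewrite EFinM.
rewrite integralZl //; first by rewrite normal_mean0 mule0.
apply/integrableP; split; first exact/measurable_EFinP.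
exact: normal_abs_moment_fin.
Qed.

End GaussianVector.

Section GaussianNoise.
Context {R : realType} {n : nat} {d : measure_display} {T : measurableType d}.
Variable P : probability T R.
Variables (X : T -> 'cV[R]_n) (gX : std_gaussian P X).
Local Notation N01 := (@normal_prob R 0 1).
Local Open Scope ereal_scope.

Let mX i : measurable_fun setT (fun w => X w i 0%R).
Proof. by case: gX => /random_vector_entries. Qed.

Lemma std_gaussian_marginal i A : measurable A ->
  P ((fun w => X w i 0%R) @^-1` A) = N01 A.
Proof.
move=> mA; have [_ prodX] := gX.
pose B j := if j == i then A else [set: R].
have mB j : measurable (B j) by rewrite /B; case: ifP.
have := prodX B mB; rewrite (bigD1 i) //= {2}/B eqxx big1 ?mule1 => [<-|j ji].
  congr (P _); apply/seteqP; split => w /=.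
    by move=> AX j; rewrite /B; case: eqP => // ->.
  by move=> /(_ i); rewrite /B eqxx.
by rewrite /B (negbTE ji); exact: (@probability_setT _ _ _ N01).
Qed.

Lemma std_gaussian_pair i j A B : i != j -> measurable A -> measurable B ->
  P ((fun w => X w i 0%R) @^-1` A `&` (fun w => X w j 0%R) @^-1` B) =
  N01 A * N01 B.
Proof.
move=> ij mA mB; have [_ prodX] := gX.
pose C k := if k == i then A else if k == j then B else [set: R].
have mC k : measurable (C k) by rewrite /C; case: ifP => // _; case: ifP.
have := prodX C mC; rewrite (bigD1 i) //= (bigD1 j) 1?eq_sym //=.
rewrite {2 3}/C !eqxx (eq_sym j) (negbTE ij) big1 ?mule1 => [<-|k /andP[ki kj]].
  congr (P _); apply/seteqP; split => w /=.
    by move=> [AX BX] k; rewrite /C; case: eqP => [->|_] //; case: eqP => // ->.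
  move=> CX; split; first by have := CX i; rewrite /C eqxx.
  by have := CX j; rewrite /C eqxx eq_sym (negbTE ij).
rewrite /C (negbTE ki) (negbTE kj); exact: (@probability_setT _ _ _ N01).
Qed.

Variable M : R.
Hypothesis le_M : \int[N01]_x (x ^+ 2)%:E <= M%:E.

Lemma std_gaussian_sqr i : \int[P]_w (X w i 0%R ^+ 2)%:E <= M%:E.
Proof.
rewrite (normal_ge0_transfer (mX i) (std_gaussian_marginal i)
  (h := fun x => (x ^+ 2)%:E)) //.
- by apply/measurable_EFinP; exact: measurable_funX.
- by move=> x; rewrite lee_fin sqr_ge0.
Qed.

Let integrable_sqr i : P.-integrable setT (fun w => (X w i 0%R ^+ 2)%:E).
Proof.
apply/integrableP; split.
  by apply/measurable_EFinP; exact: measurable_funX.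
under eq_integral do rewrite gee0_abs ?lee_fin ?sqr_ge0 //.
by rewrite (le_lt_trans (std_gaussian_sqr i)) // ltry.
Qed.

Lemma std_gaussian_prod_integrable i j :
  P.-integrable setT (fun w => (X w i 0%R * X w j 0%R)%:E).
Proof.
apply: le_integrable
  (integrableD measurableT (integrable_sqr i) (integrable_sqr j)) => //.
- by apply/measurable_EFinP; exact: measurable_funM.
- move=> w _ /=; rewrite lee_fin [leRHS]ger0_norm ?addr_ge0 ?sqr_ge0 //.
  set a := X w i _; set b := X w j _.
  rewrite ler_norml; have := sqr_ge0 (a - b); have := sqr_ge0 (a + b).
  rewrite sqrrB sqrrD mulr2n; have := sqr_ge0 a; have := sqr_ge0 b.
  by move=> *; apply/andP; split; lra.
Qed.

Lemma std_gaussian_uncorrelated i j : i != j ->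
  \int[P]_w (X w i 0%R * X w j 0%R)%:E = 0.
Proof.
move=> ij; apply: normal_pair_uncorrelated => //.
  by move=> A B; exact: std_gaussian_pair.
exact: std_gaussian_prod_integrable.
Qed.

(** Expanding |S X|^2 into the quadratic form of S^T S, the off-diagonal terms
    have zero expectation.  A Cauchy-Schwarz bound instead would lose a factor
    equal to the dimension, on which the constants may not depend. *)
Lemma gaussian_noise_second_moment (S : 'M[R]_n) :
  'E_P[fun w => (enorm (S *m X w) ^+ 2)%R] <= (M * \tr (S^T *m S))%:E.
Proof.
pose Q := (S^T *m S)%R.
have Q_ge0 i : (0 <= Q i i)%R.
  by rewrite /Q mxE sumr_ge0 // => k _; rewrite mxE -expr2 sqr_ge0.
have normE w : (enorm (S *m X w) ^+ 2 =
    \sum_i \sum_j Q i j * (X w i 0 * X w j 0))%R.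
  rewrite enorm2E.
  have -> : (dotp (S *m X w) (S *m X w) = ((X w)^T *m (Q *m X w)) 0 0)%R.
    rewrite /Q -mulmxA mulmxA -trmx_mul mxE; apply: eq_bigr => i _.
    by rewrite [((S *m X w)^T)%R 0%R i]mxE.
  rewrite mxE; apply: eq_bigr => i _;
  rewrite [((X w)^T)%R 0%R i]mxE [(Q *m X w)%R i 0%R]mxE mulr_sumr.
  by apply: eq_bigr => j _; rewrite mulrCA.
rewrite unlock.
under eq_integral do rewrite normE -sumEFin.
rewrite integral_sum // => [|i]; last first.
  under eq_fun do rewrite -sumEFin.
  apply: integrable_sum => // j _; under eq_fun do rewrite EFinM.
  by apply: integrableZl => //; exact: std_gaussian_prod_integrable.
have -> : (M * \tr (S^T *m S))%:E = \sum_i (Q i i * M)%:E.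
  by rewrite sumEFin /mxtrace mulr_sumr; under eq_bigr do rewrite mulrC.
apply: lee_sum => i _.
under eq_integral do rewrite -sumEFin.
rewrite integral_sum // => [|j]; last first.
  under eq_fun do rewrite EFinM.
  by apply: integrableZl => //; exact: std_gaussian_prod_integrable.
rewrite (bigD1 i) //= big1 ?adde0 => [|j ji].
  under eq_integral do rewrite EFinM.
  rewrite integralZl //; last exact: std_gaussian_prod_integrable.
  rewrite EFinM; apply: lee_wpmul2l; rewrite ?lee_fin //.
  exact: std_gaussian_sqr.
under eq_integral do rewrite EFinM.
rewrite integralZl //; last exact: std_gaussian_prod_integrable.
by rewrite std_gaussian_uncorrelated ?mule0 // eq_sym.
Qed.

End GaussianNoise.

(** * One step of the implicit scheme *)

Section SchemeStep.
Context {R : realType} {n : nat} {mu L gamma alpha : R} {f : 'cV[R]_n -> R}.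
Hypothesis mu_gt0 : 0 < mu.
Hypothesis mu_le_L : mu <= L.
Hypothesis gamma_gt0 : 0 < gamma.
Hypothesis alpha_ge1 : 1 <= alpha.
Hypothesis fP : strongly_convex_smooth mu L f.
Local Notation t := (tau mu alpha gamma).

Let alpha_gt0 : 0 < alpha. Proof. exact: lt_le_trans alpha_ge1. Qed.

Lemma tau_ge0 : 0 <= t.
Proof. by rewrite addr_ge0 ?invr_ge0 ?divr_ge0 // ltW. Qed.

Lemma lambda_ge0 : 0 <= lambda mu alpha gamma.
Proof.
rewrite divr_ge0 ?ltW // mulr_gt0 //.
by rewrite ltr_wpDr ?tau_ge0.
Qed.

(** Multiplied by (1 + tau)^2, the contraction of the proximal step has the
    factor (1 + tau + alpha mu / gamma)^2 >= (alpha mu / gamma)^2 on its left,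
    which is the source of the division by alpha^2. *)
Lemma implicit_step_bound (x v e p xstar : 'cV[R]_n) :
    is_argmin f xstar ->
    is_prox (lambda mu alpha gamma) f
      ((1 + t)^-1 *: (v + t *: x) + (Num.sqrt alpha / (1 + t)) *: e) p ->
  dotp (p - xstar) (p - xstar) <=
  3 * gamma ^+ 2 / mu ^+ 2 *
    (dotp (v - xstar) (v - xstar) / alpha ^+ 2 +
     t ^+ 2 / alpha ^+ 2 * dotp (x - xstar) (x - xstar) +
     dotp e e / alpha).
Proof.
move=> minx; set z := _ + _ => prox_p.
have := prox_contraction mu_gt0 mu_le_L fP lambda_ge0 minx prox_p.
set D := dotp (p - xstar) _; set Z := z - xstar => DZ.
have s_gt0 : 0 < 1 + t by rewrite ltr_wpDr ?tau_ge0.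
have sZ : (1 + t) *: Z =
    (v - xstar) + t *: (x - xstar) + Num.sqrt alpha *: e.
  by apply/colP => i; rewrite !mxE; field; rewrite gt_eqF.
have := dotpDDD_le (v - xstar) (t *: (x - xstar)) (Num.sqrt alpha *: e).
rewrite -sZ !(dotpZl, dotpZr).
have -> (y : R) : Num.sqrt alpha * (Num.sqrt alpha * y) = alpha * y.
  by rewrite mulrA -expr2 sqr_sqrtr // ltW.
set V := dotp (v - _) _; set X := dotp (x - _) _; set E := dotp e e.
move=> boundZ.
have D_ge0 : 0 <= D by exact: dotp_ge0.
have sm : (1 + t) * (1 + lambda mu alpha gamma * mu) =
    1 + t + alpha * mu / gamma.
  by rewrite /lambda; field; rewrite !gt_eqF.
have step : (alpha * mu / gamma) ^+ 2 * D <=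
    3 * (V + t ^+ 2 * X + alpha * E).
  apply: (@le_trans _ _ ((1 + t) ^+ 2 * dotp Z Z)); last first.
    by move: boundZ; rewrite !expr2 -!mulrA.
  apply: (@le_trans _ _
      ((1 + t) ^+ 2 * ((1 + lambda mu alpha gamma * mu) ^+ 2 * D))).
    have q_ge0 : 0 <= alpha * mu / gamma.
      by apply/ltW; rewrite divr_gt0 ?mulr_gt0.
    rewrite mulrA -exprMn sm ler_wpM2r // lerXn2r ?nnegrE //.
      by rewrite addr_ge0 // ltW.
    by rewrite lerDr ltW.
  by rewrite ler_wpM2l ?sqr_ge0.
have -> : 3 * gamma ^+ 2 / mu ^+ 2 *
    (V / alpha ^+ 2 + t ^+ 2 / alpha ^+ 2 * X + E / alpha) =
    ((alpha * mu / gamma) ^+ 2)^-1 * (3 * (V + t ^+ 2 * X + alpha * E)).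
  by field; rewrite !gt_eqF.
by rewrite -ler_pdivrMl ?invr_gt0 ?exprn_gt0 ?divr_gt0 ?mulr_gt0 // invrK.
Qed.

(** The constant 8 comes from 2 (1 + 1 / alpha)^2 <= 8 for alpha >= 1. *)
Lemma velocity_bound (x y v xstar : 'cV[R]_n) :
  v = x + alpha^-1 *: (x - y) ->
  dotp (v - xstar) (v - xstar) <=
  8 * dotp (x - xstar) (x - xstar) +
  2 / alpha ^+ 2 * dotp (y - xstar) (y - xstar).
Proof.
move=> ->.
have -> : x + alpha^-1 *: (x - y) - xstar =
    (1 + alpha^-1) *: (x - xstar) + (- alpha^-1) *: (y - xstar).
  by apply/colP => i; rewrite !mxE; ring.
apply: le_trans (dotpDD_le _ _) _.
rewrite !(dotpZl, dotpZr) mulrDr; apply: lerD.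
  rewrite !mulrA ler_wpM2r ?dotp_ge0 //.
  have : alpha^-1 <= 1 by rewrite invf_le1.
  have : 0 <= alpha^-1 by rewrite invr_ge0 ltW.
  set a := alpha^-1; nra.
by rewrite !mulNr mulrN opprK !mulrA -(mulrA 2) -invfM -expr2.
Qed.

End SchemeStep.

(** * Affine recursions *)

Section RealRecursion.
Context {R : realType}.
Implicit Types (u : nat -> R) (r c a b : R).

Lemma affine_recursion_le u r c : 0 <= r -> r != 1 ->
    (forall k, u k.+1 <= r * u k + c) ->
  forall k, u k <= r ^+ k * u 0%N + c * ((1 - r ^+ k) / (1 - r)).
Proof.
move=> r_ge0 r1 uS; have r1' : 1 - r != 0 by rewrite subr_eq0 eq_sym.
elim=> [|k IH]; first by rewrite expr0 subrr mul0r mulr0 addr0 mul1r.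
apply: le_trans (uS k) _.
have -> : r ^+ k.+1 * u 0%N + c * ((1 - r ^+ k.+1) / (1 - r)) =
    r * (r ^+ k * u 0%N + c * ((1 - r ^+ k) / (1 - r))) + c.
  by rewrite exprS; field.
by rewrite lerD2r ler_wpM2l.
Qed.

Lemma limn_esup_geometric_le (u : nat -> R) r a b : 0 <= r < 1 ->
    (forall k, u k.+1 <= r ^+ k * a + b) ->
  (limn_esup (fun k => (u k)%:E) <= b%:E)%E.
Proof.
move=> /andP[r_ge0 r_lt1] ub; apply/lee_addgt0Pr => e e_gt0.
have : r ^+ k * a @[k --> \oo] --> 0 * a.
  by apply: cvgMl; apply: cvg_expr; rewrite ger0_norm.
rewrite mul0r => /cvgrPdist_lt /(_ e e_gt0)[N _ HN].
rewrite limn_esup_lim; apply: lime_le; first exact: is_cvg_esups.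
exists N.+1 => // m /= Nm; apply: ge_ereal_sup => _ [k /= mk <-].
case: k mk => [|k] mk; first by move: (leq_trans Nm mk).
rewrite -EFinD lee_fin; apply: le_trans (ub k) _; rewrite addrC lerD2l.
have := HN k (leq_trans Nm mk); rewrite /= sub0r normrN => /ltW.
exact: le_trans (ler_norm _).
Qed.

End RealRecursion.

(** * Mean square errors of the iterates *)

Section Expectation.
Context {R : realType} {d : measure_display} {T : measurableType d}.
Variable P : probability T R.
Implicit Types X Y Z W : T -> R.

Lemma expectation_lin3_le X Y Z W (a b c : R) :
    measurable_fun setT X -> measurable_fun setT Y ->
    measurable_fun setT Z -> measurable_fun setT W ->
    (forall w, 0 <= X w) -> (forall w, 0 <= Y w) -> (forall w, 0 <= Z w) ->
    (forall w, 0 <= W w) -> 0 <= a -> 0 <= b -> 0 <= c ->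
    (forall w, W w <= a * X w + b * Y w + c * Z w) ->
  ('E_P[W] <= a%:E * 'E_P[X] + b%:E * 'E_P[Y] + c%:E * 'E_P[Z])%E.
Proof.
move=> mX mY mZ mW X0 Y0 Z0 W0 a0 b0 c0 WXYZ; rewrite unlock.
have mE (g : T -> R) : measurable_fun setT g ->
    measurable_fun setT (fun w => (g w)%:E) by move=> ?; exact/measurable_EFinP.
have mM (k : R) (g : T -> R) : measurable_fun setT g ->
    measurable_fun setT (fun w => k%:E * (g w)%:E)%E.
  by move=> mg; apply: emeasurable_funM => //; exact: mE.
have pos (g : T -> R) : (forall w, 0 <= g w) ->
    forall w, setT w -> (0 <= (g w)%:E)%E by move=> g0 w _; rewrite lee_fin.
have posM (k : R) (g : T -> R) : 0 <= k -> (forall w, 0 <= g w) ->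
    forall w, setT w -> (0 <= k%:E * (g w)%:E)%E.
  by move=> k0 g0 w _; rewrite mule_ge0 ?lee_fin.
rewrite -(ge0_integralZl _ _ (mE _ mX) (pos _ X0)) //.
rewrite -(ge0_integralZl _ _ (mE _ mY) (pos _ Y0)) //.
rewrite -(ge0_integralZl _ _ (mE _ mZ) (pos _ Z0)) //.
rewrite -(ge0_integralD _ _ (posM _ _ a0 X0) (mM _ _ mX) (posM _ _ b0 Y0)) //;
  last exact: mM.
rewrite -(ge0_integralD _ _ _ _ (posM _ _ c0 Z0)) //;
  [|move=> w _|apply: emeasurable_funD|]; last 1 first.
- exact: mM.
- apply: ge0_le_integral => //.
  + exact: pos.
  + exact: mE.
  + by apply: emeasurable_funD; [apply: emeasurable_funD|]; exact: mM.
  + by move=> w _; rewrite -!EFinM -!EFinD lee_fin.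
- by rewrite adde_ge0 // (posM, posM).
- exact: mM.
- exact: mM.
Qed.

End Expectation.

Section MeanSquareError.
Context {R : realType} {n : nat} {mu L gamma alpha M sigma2 : R}.
Context {f : 'cV[R]_n -> R} {xstar : 'cV[R]_n}.
Context {d : measure_display} {Omega : measurableType d}.
Variable P : probability Omega R.
Context {eta : nat -> Omega -> 'cV[R]_n} {S : 'M[R]_n} {x0 v0 : 'cV[R]_n}.
Context {x v : nat -> Omega -> 'cV[R]_n}.
Hypothesis mu_gt0 : 0 < mu.
Hypothesis mu_le_L : mu <= L.
Hypothesis gamma_gt0 : 0 < gamma.
Hypothesis alpha_ge1 : 1 <= alpha.
Hypothesis fP : strongly_convex_smooth mu L f.
Hypothesis minx : is_argmin f xstar.
Hypothesis meta : forall k, random_vector (eta k).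
Hypothesis noise_le : forall k,
  ('E_P[fun w => (enorm (S *m eta k w) ^+ 2)%R] <= (M * sigma2)%:E)%E.
Hypothesis scheme : implicit_scheme f mu alpha gamma S eta x0 v0 x v.
Local Notation t := (tau mu alpha gamma).

Let alpha_gt0 : 0 < alpha. Proof. exact: lt_le_trans alpha_ge1. Qed.

Let noise_entries k : measurable_entries (fun w => S *m eta k w).
Proof.
move=> i; under eq_fun do rewrite mxE.
apply: measurable_sum => j; apply: measurable_funM => //.
exact: random_vector_entries.
Qed.

(** Measurability propagates along the recursion since x_{k+1} is a 1-Lipschitz
    function of the measurable argument of the proximal map. *)
Lemma scheme_entries k : measurable_entries (x k) /\ measurable_entries (v k).
Proof.
elim: k => [|k [mx mv]].
  have x0E w : x 0 w = x0 by have [] := scheme w.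
  have v0E w : v 0 w = v0 by have [] := scheme w.
  split=> i; [under eq_fun do rewrite x0E|under eq_fun do rewrite v0E];
    exact: measurable_cst.
pose z w := (1 + t)^-1 *: (v k w + t *: x k w) +
            (Num.sqrt alpha / (1 + t)) *: (S *m eta k w).
have mz : measurable_entries z.
  move=> i; rewrite /z; under eq_fun do rewrite !mxE.
  apply: measurable_funD; apply: measurable_funM => //.
    by apply: measurable_funD => //; apply: measurable_funM.
  by have := noise_entries k i; under eq_fun do rewrite mxE.
have prox_x w : is_prox (lambda mu alpha gamma) f (z w) (x k.+1 w).
  by have [_ _ /(_ k)[]] := scheme w.
have mx1 : measurable_entries (x k.+1).
  move=> i; apply: (lipschitz_measurable mz) => w w'.
  have l_ge0 := lambda_ge0 mu_gt0 gamma_gt0 alpha_ge1.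
  have := prox_nonexpansive mu_gt0 mu_le_L fP l_ge0 (prox_x w) (prox_x w').
  have := entry_le_enorm (x k.+1 w - x k.+1 w') i; rewrite !mxE => h1 h2.
  apply: le_trans h1 (le_trans h2 (le_trans (enorm_le_sum _) _)).
  by apply: ler_sum => j _; rewrite !mxE.
split=> // i; under eq_fun => w.
  have [_ _ /(_ k)[_ ->]] := scheme w; rewrite !mxE; over.
by apply: measurable_funD => //; apply: measurable_funM => //; apply: measurable_funB.
Qed.

Lemma measurable_sqdist (X : Omega -> 'cV[R]_n) (c : 'cV[R]_n) :
  measurable_entries X -> measurable_fun setT (fun w => enorm (X w - c) ^+ 2).
Proof.
move=> mX; under eq_fun do rewrite enorm2E /dotp.
apply: measurable_sum => i; under eq_fun do rewrite !mxE.
by apply: measurable_funM; apply: measurable_funB => //; exact: mX.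
Qed.

Let K : R := 3 * gamma ^+ 2 / mu ^+ 2.

Let K_ge0 : 0 <= K.
Proof. by rewrite divr_ge0 ?sqr_ge0 // mulr_ge0 ?sqr_ge0. Qed.

Let mse k := mean_sq_error P x xstar k.

Let mse_ge0 k : (0 <= mse k)%E.
Proof. by apply: expectation_ge0 => w; exact: sqr_ge0. Qed.

(** The bound on the velocity is left as a parameter because it has two
    sources: for k >= 1 it involves the previous iterate ([mse_recursion]),
    while at k = 0 the velocity is the arbitrary constant v0
    ([mse_fin_num]). *)
Lemma mse_step (k : nat) (g : Omega -> R) (a b : R) :
    measurable_fun setT g -> (forall w, 0 <= g w) -> 0 <= a -> 0 <= b ->
    (forall w, enorm (v k w - xstar) ^+ 2 <=
       a * enorm (x k w - xstar) ^+ 2 + b * g w) ->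
  (mse k.+1 <= (K * (a + t ^+ 2) / alpha ^+ 2)%:E * mse k +
     (K * b / alpha ^+ 2)%:E * 'E_P[g] + (K * M * sigma2 / alpha)%:E)%E.
Proof.
move=> mg g0 a0 b0 vb.
have a2 : 0 <= alpha ^+ 2 by exact: sqr_ge0.
apply: (@le_trans _ _ ((K * (a + t ^+ 2) / alpha ^+ 2)%:E * mse k +
     (K * b / alpha ^+ 2)%:E * 'E_P[g] +
     (K / alpha)%:E * 'E_P[fun w => (enorm (S *m eta k w) ^+ 2)%R])%E).
  apply: expectation_lin3_le => //.
  - exact: measurable_sqdist (scheme_entries _).1.
  - under eq_fun do rewrite -[_ *m _]subr0.
    exact: measurable_sqdist (noise_entries k).
  - exact: measurable_sqdist (scheme_entries _).1.
  - by move=> w; exact: sqr_ge0.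
  - by move=> w; exact: sqr_ge0.
  - by move=> w; exact: sqr_ge0.
  - by rewrite divr_ge0 // mulr_ge0 // addr_ge0 // sqr_ge0.
  - by rewrite divr_ge0 // mulr_ge0.
  - by rewrite divr_ge0 // ltW.
  move=> w; have [_ _ /(_ k)[prox_x _]] := scheme w.
  have := implicit_step_bound mu_gt0 mu_le_L gamma_gt0 alpha_ge1 fP minx prox_x.
  have := vb w; rewrite !enorm2E -/K => {}vb h; apply: le_trans h _.
  have -> (X E G : R) : K * (a + t ^+ 2) / alpha ^+ 2 * X +
      K * b / alpha ^+ 2 * G + K / alpha * E =
      K * ((a * X + b * G) / alpha ^+ 2 + t ^+ 2 / alpha ^+ 2 * X + E / alpha).
    by field; rewrite gt_eqF.
  by rewrite ler_wpM2l // !lerD2r ler_wpM2r ?invr_ge0.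
apply: leeD2l.
have -> : K * M * sigma2 / alpha = K / alpha * (M * sigma2) by ring.
by rewrite (EFinM (K / alpha)); apply: lee_wpmul2l => //; rewrite lee_fin divr_ge0 // ltW.
Qed.

Lemma mse_recursion (k : nat) :
  (mse k.+2 <= (K * (8 + t ^+ 2) / alpha ^+ 2)%:E * mse k.+1 +
     (K * (2 / alpha ^+ 2) / alpha ^+ 2)%:E * mse k +
     (K * M * sigma2 / alpha)%:E)%E.
Proof.
apply: mse_step => //.
- exact: measurable_sqdist (scheme_entries _).1.
- by move=> w; exact: sqr_ge0.
- by rewrite divr_ge0 ?sqr_ge0.
- move=> w; rewrite !enorm2E; apply: (velocity_bound alpha_ge1).
  by have [_ _ /(_ k)[]] := scheme w.
Qed.

(** Finiteness lets the extended-real statements be read as real ones.  It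
    starts from the constant initial data and is carried by the recursion, two
    steps at a time. *)
Lemma mse_fin_num k : mse k \is a fin_num.
Proof.
suff : mse k \is a fin_num /\ mse k.+1 \is a fin_num by case.
have finite2 (a b c : R) (X Y Z : \bar R) : (0 <= Z)%E ->
    X \is a fin_num -> Y \is a fin_num ->
    (Z <= a%:E * X + b%:E * Y + c%:E)%E -> Z \is a fin_num.
  move=> Z0 fX fY le_Z; rewrite ge0_fin_numE // (le_lt_trans le_Z) //.
  by rewrite -(fineK fX) -(fineK fY) -!EFinM -!EFinD ltry.
elim: k => [|k [fk fSk]]; last first.
  by split=> //; exact: (finite2 _ _ _ _ _ _ (mse_ge0 _) fSk fk (mse_recursion k)).
have f0 : mse 0 \is a fin_num.
  rewrite /mse /mean_sq_error (_ : (fun w => _) = cst (enorm (x0 - xstar) ^+ 2)).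
    by rewrite expectation_cst.
  by apply/funext => w; have [-> _] := scheme w.
split=> //.
apply: (finite2 _ _ _ _ _ _ (mse_ge0 _) f0 _ (@mse_step 0
  (cst (enorm (v0 - xstar) ^+ 2)) 0 1 _ _ _ _ _)) => //.
- by rewrite expectation_cst.
- by move=> w; exact: sqr_ge0.
- by move=> w; have [_ -> _] := scheme w; rewrite mul0r add0r mul1r.
Qed.

End MeanSquareError.

(** * The Lyapunov estimate *)

(** A factor M >= 1 bounding the scalar second moment covers both forms of the
    noise proxy at once; in the second form the proxy is nonnegative because it
    dominates an expectation of squares. *)
Lemma noise_proxy_bound (R : realType) (n : nat) (d : measure_display)
    (Omega : measurableType d) (P : probability Omega R)
    (eta : nat -> Omega -> 'cV[R]_n) (Sigma S : 'M[R]_n) (sigma2 M : R) :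
    1 <= M -> (\int[@normal_prob R 0 1]_x (x ^+ 2)%:E <= M%:E)%E ->
    (forall k, std_gaussian P (eta k)) -> is_sqrtmx Sigma S ->
    noise_proxy P Sigma S eta sigma2 ->
  forall k, ('E_P[fun w => (enorm (S *m eta k w) ^+ 2)%R] <= (M * sigma2)%:E)%E.
Proof.
move=> M_ge1 le_M gauss [[symS _] SS] [->|le_s] k.
  have := gaussian_noise_second_moment (gauss k) le_M S.
  by rewrite symS SS.
apply: le_trans (le_s k) _; rewrite lee_fin ler_peMl // -lee_fin.
by apply: le_trans (le_s k); apply: expectation_ge0 => w; exact: sqr_ge0.
Qed.

(** The parameter t stands for tau, which depends on the stepsize, and t1 for
    its value at alpha = 1, which dominates it.  For a >= 1, the term p1 / a^2
    is absorbed by p1 / a, and p0 / a^4 by (1 / a) (p0 / a). *)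
Lemma lyapunov_contraction (R : realType) (K t t1 a s p0 p1 p2 : R) :
    0 <= K -> 0 <= t <= t1 -> 1 <= a -> 0 <= p0 -> 0 <= p1 ->
    p2 <= K * (8 + t ^+ 2) / a ^+ 2 * p1 + K * (2 / a ^+ 2) / a ^+ 2 * p0 + s ->
  p2 + a^-1 * p1 <= (K * (8 + t1 ^+ 2) + 2 * K + 1) / a * (p1 + a^-1 * p0) + s.
Proof.
move=> K_ge0 /andP[t_ge0 le_t] a_ge1 p0_ge0 p1_ge0.
have a_gt0 : 0 < a by exact: lt_le_trans a_ge1.
have b_ge0 : 0 <= a^-1 by rewrite invr_ge0 ltW.
have b_le1 : a^-1 <= 1 by rewrite invf_le1.
have b2 : a^-1 ^+ 2 <= a^-1 by rewrite expr2 ler_piMl.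
have b2_ge0 : 0 <= a^-1 ^+ 2 by exact: sqr_ge0.
have b4 : a^-1 ^+ 2 * a^-1 ^+ 2 <= a^-1 ^+ 2.
  by rewrite ler_piMl // (le_trans b2).
rewrite -!(exprVn a); move: b_ge0 b_le1 b2 b2_ge0 b4; set b := a^-1.
move=> b_ge0 b_le1 b2 b2_ge0 b4 le_p2.
have t2 : t ^+ 2 <= t1 ^+ 2 by rewrite lerXn2r ?nnegrE // (le_trans t_ge0).
pose A := K * (8 + t1 ^+ 2).
have A_ge0 : 0 <= A by rewrite mulr_ge0 ?addr_ge0 ?sqr_ge0.
have h1 : K * (8 + t ^+ 2) * b ^+ 2 * p1 <= A * b * p1.
  rewrite ler_wpM2r // ler_pM ?mulr_ge0 ?addr_ge0 ?sqr_ge0 //.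
  by rewrite ler_wpM2l // lerD2l.
have h2 : K * (2 * b ^+ 2) * b ^+ 2 * p0 <= 2 * K * b ^+ 2 * p0.
  rewrite ler_wpM2r //.
  have -> : K * (2 * b ^+ 2) * b ^+ 2 = 2 * K * (b ^+ 2 * b ^+ 2) by ring.
  by rewrite ler_wpM2l ?mulr_ge0.
have h3 : 0 <= (A + 1) * b ^+ 2 * p0.
  by rewrite !mulr_ge0 // addr_ge0.
have h4 : 0 <= 2 * K * b * p1 by rewrite !mulr_ge0.
have -> : (K * (8 + t1 ^+ 2) + 2 * K + 1) * b * (p1 + b * p0) + s =
   A * b * p1 + 2 * K * b ^+ 2 * p0 + (A + 1) * b ^+ 2 * p0 +
   2 * K * b * p1 + b * p1 + s by rewrite /A; ring.
lra.
Qed.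

Theorem theorem3p1 (R : realType) (mu L gamma : R)
    (mu_gt0 : 0 < mu) (mu_le_L : mu <= L) (gamma_gt0 : 0 < gamma) :
  exists (G C theta1 theta2 : R) (theta : R -> R),
    [/\ 0 < G, 0 < C, 0 < theta1 <= theta2,
        forall alpha : R, 1 <= alpha ->
          0 < theta alpha /\ theta1 / alpha <= theta alpha <= theta2 / alpha &
    forall (n : nat) (f : 'cV[R]_n -> R) (xstar : 'cV[R]_n)
      (d : measure_display) (Omega : measurableType d)
      (P : probability Omega R) (eta : nat -> Omega -> 'cV[R]_n)
      (Sigma sqrtSigma : 'M[R]_n) (sigma2 alpha : R)
      (x0 v0 : 'cV[R]_n) (x v : nat -> Omega -> 'cV[R]_n),
      strongly_convex_smooth mu L f ->
      is_argmin f xstar ->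
      (forall k, std_gaussian P (eta k)) ->
      mutually_independent P eta ->
      psdmx Sigma ->
      is_sqrtmx Sigma sqrtSigma ->
      noise_proxy P Sigma sqrtSigma eta sigma2 ->
      1 <= alpha ->
      implicit_scheme f mu alpha gamma sqrtSigma eta x0 v0 x v ->
      let V := lyapunov P x xstar (theta alpha) in
      let rho := G / alpha in
      [/\ forall k, (1 <= k)%N ->
            (V k.+1 <= rho%:E * V k + (C * sigma2 / alpha)%:E)%E,
          G < alpha ->
            [/\ 0 < rho < 1,
                forall k, (1 <= k)%N ->
                  (V k <= (rho ^+ k.-1)%:E * V 1%N +
                     (C * sigma2 / alpha
                        * ((1 - rho ^+ k.-1) / (1 - rho)))%:E)%E &
                forall k, (1 <= k)%N ->
                  (mean_sq_error P x xstar k <= V k)%E /\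
                  (V k <= (rho ^+ k.-1)%:E * V 1%N +
                     (C * sigma2 / (alpha * (1 - G / alpha)))%:E)%E] &
          2 * G <= alpha ->
            (limn_esup (mean_sq_error P x xstar)
               <= (2 * C / alpha * sigma2)%:E)%E]].
Proof.
have [M M_ge1 le_M] := @normal_second_moment_bounded R.
pose K := 3 * gamma ^+ 2 / mu ^+ 2; pose t1 := 1 + mu / gamma.
pose G := K * (8 + t1 ^+ 2) + 2 * K + 1.
have K_gt0 : 0 < K by rewrite divr_gt0 ?mulr_gt0 ?exprn_gt0.
have G_gt0 : 0 < G.
  by rewrite ltr_wpDl // addr_ge0 // mulr_ge0 ?addr_ge0 ?sqr_ge0 // ltW.
exists G, (K * M), 1, 1, GRing.inv; split=> //.
- by rewrite mulr_gt0 // (lt_le_trans _ M_ge1).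
- by rewrite ltr01 lexx.
- move=> alpha alpha_ge1; rewrite !mul1r lexx invr_gt0.
  by rewrite (lt_le_trans _ alpha_ge1).
move=> n f xstar d Omega P eta Sigma S sigma2 alpha x0 v0 x v.
move=> fP minx gauss _ _ sqrtS proxy alpha_ge1 scheme V rho.
have alpha_gt0 : 0 < alpha by exact: lt_le_trans alpha_ge1.
have noise_le := noise_proxy_bound M_ge1 le_M gauss sqrtS proxy.
have sigma2_ge0 : 0 <= K * M * sigma2 / alpha.
  rewrite divr_ge0 ?(ltW alpha_gt0) // -mulrA mulr_ge0 ?(ltW K_gt0) // -lee_fin.
  by apply: le_trans (noise_le 0%N); apply: expectation_ge0 => w; exact: sqr_ge0.
have meta k : random_vector (eta k) by have [] := gauss k.
pose m k := fine (mean_sq_error P x xstar k).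
have mE k : mean_sq_error P x xstar k = (m k)%:E.
  by rewrite fineK // (mse_fin_num mu_gt0 mu_le_L gamma_gt0 alpha_ge1 fP minx
    meta noise_le scheme).
have m_ge0 k : 0 <= m k.
  by rewrite -lee_fin -mE; apply: expectation_ge0 => w; exact: sqr_ge0.
pose W k := m k + alpha^-1 * m k.-1.
have VE k : V k = (W k)%:E by rewrite /V /lyapunov !mE -EFinM -EFinD.
have W_ge0 k : 0 <= W k.
  by rewrite addr_ge0 // mulr_ge0 // invr_ge0 ltW.
have m_le_W k : m k <= W k by rewrite lerDl mulr_ge0 // invr_ge0 ltW.
have WS k : W k.+2 <= rho * W k.+1 + K * M * sigma2 / alpha.
  have t_ge0 := tau_ge0 mu_gt0 gamma_gt0 alpha_ge1.
  have le_t : 0 <= tau mu alpha gamma <= t1.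
    by rewrite t_ge0 lerD2r invf_le1.
  apply: (lyapunov_contraction (ltW K_gt0) le_t) => //.
  have := mse_recursion mu_gt0 mu_le_L gamma_gt0 alpha_ge1 fP minx meta
    noise_le scheme k.
  by rewrite !mE -!EFinM -!EFinD lee_fin.
have rho_gt0 : 0 < rho by rewrite divr_gt0.
have Wgeo : rho < 1 -> forall k, W k.+1 <= rho ^+ k * W 1%N +
    K * M * sigma2 / alpha * ((1 - rho ^+ k) / (1 - rho)).
  move=> rho_lt1.
  by apply: (@affine_recursion_le _ (fun k => W k.+1)); rewrite ?ltW ?lt_eqF.
have Wgeo' : rho < 1 -> forall k, W k.+1 <= rho ^+ k * W 1%N +
    K * M * sigma2 / (alpha * (1 - rho)).
  move=> rho_lt1 k; apply: le_trans (Wgeo rho_lt1 k) _.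
  rewrite lerD2l invfM [leRHS]mulrA ler_wpM2l //.
  rewrite ler_piMl ?invr_ge0 ?subr_ge0 ?(ltW rho_lt1) //.
  by rewrite lerBlDr lerDl exprn_ge0 // ltW.
split.
- by case=> // k _; rewrite !VE -EFinM -EFinD lee_fin.
- move=> G_lt; have rho_lt1 : rho < 1 by rewrite ltr_pdivrMr // mul1r.
  split; first by rewrite rho_gt0.
  + by case=> // k _; rewrite !VE -EFinM -EFinD lee_fin; exact: Wgeo.
  + case=> // k _; rewrite mE !VE -EFinM -EFinD !lee_fin.
    by split => //; exact: Wgeo'.
- move=> G2_le; have rho_le : rho <= 2^-1.
    by rewrite ler_pdivrMr // ler_pdivlMl.
  have rho_lt1 : rho < 1 by apply: le_lt_trans rho_le _; rewrite invf_lt1 // ltr1n.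
  have -> : mean_sq_error P x xstar = (fun k => (m k)%:E) by apply/funext.
  (* For rho <= 1/2 the factor 1 / (1 - rho) of the stationary bound is at
     most 2. *)
  apply: (@limn_esup_geometric_le _ m rho (W 1%N)) => [|k].
    by rewrite ltW.
  apply: le_trans (m_le_W _) (le_trans (Wgeo' rho_lt1 k) _).
  rewrite lerD2l.
  have -> : 2 * (K * M) / alpha * sigma2 = K * M * sigma2 / alpha * 2 by ring.
  rewrite invfM mulrA ler_wpM2l // -[leRHS]invrK lef_pV2 ?posrE ?subr_gt0 //.
  rewrite lerBrDr -lerBrDl; apply: le_trans rho_le _; lra.
Qed.
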